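(* Let $A$ be a perfect evolution algebra of finite dimension $n\geq 2$ over a field $\mathbb K$, and let $I$ be a maximal $i$-basic ideal of $A$ whose dimension $i$ is $1$, $n-1$ or $n/2$ ($n$ being even in this last case). Then $A/I$ is a basic simple perfect evolution algebra.
   Context: An evolution algebra over a field $\mathbb K$ is a (not necessarily associative) $\mathbb K$-algebra $A$ having a basis $B=\{e_j \mid j\in\Lambda\}$ with $e_je_k=0$ whenever $j\neq k$; such a basis is called a natural basis. $A$ is perfect if $A^2=A$, where $A^2$ is the linear span of all products. A nonzero proper ideal $I$ of $A$ is an $i$-basic ideal relative to a natural basis $B$ if $I$ is the linear span of $i$ vectors of $B$ (so $\dim I=i$); a basic ideal relative to $B$ is an ideal that is $i$-basic relative to $B$ for some $i$. $I$ is a maximal $i$-basic ideal relative to $B$ if it is $i$-basic relative to $B$ and there are no basic ideals relative to $B$ of dimension $j>i$. For a perfect finite-dimensional $A$, $I$ is called a (maximal) $i$-basic ideal if it is so relative to every natural basis of $A$ (for such $A$ these notions do not depend on the natural basis). A perfect finite-dimensional evolution algebra is basic simple if the ideal generated by any element of any natural basis is the whole algebra. *)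

(* Defs.v *)
From HB Require Import structures.
From mathcomp Require Import all_boot all_algebra.

Set Implicit Arguments.
Unset Strict Implicit.
Unset Printing Implicit Defensive.

Import GRing.Theory.
Local Open Scope ring_scope.
Local Open Scope quotient_scope.

(* MathComp algebras are associative, hence this structure for an arbitrary   *)
(* bilinear product on a finite-dimensional space.                            *)
HB.mixin Record Vector_isNonAssocAlg (K : fieldType) (A : Type)
    of Vector K A := {
  amul : A -> A -> A;
  amul_bilinear : bilinear_for *:%R *:%R amul
}.

#[short(type="nonAssocAlgType")]
HB.structure Definition NonAssocAlg (K : fieldType) :=
  {A of Vector_isNonAssocAlg K A & Vector K A}.

HB.instance Definition _ (K : fieldType) (A : nonAssocAlgType K) :=
  bilinear_isBilinear.Build K A A A *:%R *:%R (@amul K A)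
    (@amul_bilinear K A).

Definition ideal_closed (K : fieldType) (A : nonAssocAlgType K)
    (U : {vspace A}) : Prop :=
  forall x u, u \in U -> amul x u \in U /\ amul u x \in U.

Record ideal (K : fieldType) (A : nonAssocAlgType K) := Ideal {
  ideal_vspace :> {vspace A};
  ideal_closedP : ideal_closed ideal_vspace
}.

Section QuotientAlgebra.

Context {K : fieldType} {A : nonAssocAlgType K} (I : ideal A).

Definition ideal_quotient : Type := Quotient.quot (ideal_vspace I).

HB.instance Definition _ := GRing.Zmodule.on ideal_quotient.
HB.instance Definition _ := EqQuotient.on ideal_quotient.

Local Notation Q := ideal_quotient.

Lemma pi_eq (x y : A) : (\pi_Q x = \pi_Q y) <-> x - y \in ideal_vspace I.
Proof. by rewrite [_ \in _]Quotient.idealrBE; split=> /eqP. Qed.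

Lemma sub_repr_pi (x : A) : x - repr (\pi_Q x) \in ideal_vspace I.
Proof. by apply (pi_eq _ _).1; rewrite reprK. Qed.

Definition quot_scale (a : K) : Q -> Q := lift_op1 Q ( *:%R a).
Definition quot_mul : Q -> Q -> Q := lift_op2 Q amul.

Lemma pi_quotD : {morph \pi_Q : x y / x + y}.
Proof. exact: (raddfD (\pi_(Quotient.quot (ideal_vspace I)))). Qed.

Lemma pi_quot_scale a : {morph \pi_Q : x / a *: x >-> quot_scale a x}.
Proof.
move=> x; unlock quot_scale; apply/pi_eq.
by rewrite -scalerBr memvZ ?sub_repr_pi.
Qed.

Lemma pi_quot_mul : {morph \pi_Q : x y / amul x y >-> quot_mul x y}.
Proof.
move=> x y; unlock quot_mul; apply/pi_eq.
have -> : amul x y - amul (repr (\pi_Q x)) (repr (\pi_Q y)) =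
    amul (x - repr (\pi_Q x)) y + amul (repr (\pi_Q x)) (y - repr (\pi_Q y)).
  by rewrite linearBl linearBr /= addrA subrK.
apply: memvD.
  by apply: (ideal_closedP (i := I) _ _).2; apply: sub_repr_pi.
by apply: (ideal_closedP (i := I) _ _).1; apply: sub_repr_pi.
Qed.

Fact quot_scaleA a b x : quot_scale a (quot_scale b x) = quot_scale (a * b) x.
Proof. by elim/quotW: x => x; rewrite -!pi_quot_scale scalerA. Qed.

Fact quot_scale1 : left_id 1 quot_scale.
Proof. by elim/quotW=> x; rewrite -pi_quot_scale scale1r. Qed.

Fact quot_scaleDr : right_distributive quot_scale +%R.
Proof.
move=> a; elim/quotW=> x; elim/quotW=> y.
by rewrite -!pi_quot_scale -!pi_quotD -pi_quot_scale scalerDr.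
Qed.

Fact quot_scaleDl x : {morph quot_scale^~ x : a b / a + b}.
Proof.
by elim/quotW: x => x a b; rewrite -!pi_quot_scale -pi_quotD scalerDl.
Qed.

HB.instance Definition _ := GRing.Zmodule_isLmodule.Build K Q
  quot_scaleA quot_scale1 quot_scaleDr quot_scaleDl.

Fact pi_quot_linear : linear (\pi_Q : A -> Q).
Proof. by move=> a x y; rewrite pi_quotD pi_quot_scale. Qed.

(* Finite dimension: Q is isomorphic to the complement I^C of I. *)
Fact quot_hasFinDim : Vector.axiom (\dim (I^C)%VS) Q.
Proof.
pose C := (I^C)%VS; pose U := subvs_of C.
pose f (u : U) : 'rV[K]_(\dim C) :=
  \row_i coord (vbasis C) i (vsval u).
pose g (r : 'rV[K]_(\dim C)) : U :=
  vsproj C (\sum_i r 0 i *: (vbasis C)`_i).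
have f_lin : linear f.
  by move=> a u v; apply/rowP=> i; rewrite !mxE linearP.
have fK : cancel f g.
  move=> u; rewrite /g; under eq_bigr do rewrite mxE.
  by rewrite -coord_vbasis ?subvsP // vsvalK.
have gK : cancel g f.
  move=> r; apply/rowP=> i; rewrite mxE vsprojK.
    by rewrite coord_sum_free // (basis_free (vbasisP _)).
  by apply: rpred_sum => j _; rewrite rpredZ // vbasis_mem // mem_nth ?size_tuple.
pose h (x : A) : U := vsproj (I^C)%VS (x - projv I x).
have h_lin a x y : h (a *: x + y) = a *: h x + h y.
  by rewrite /h -linearP; congr vsproj; rewrite linearP scalerBr opprD addrACA.
have h_pi x : h (repr (\pi_Q x)) = h x.
  have /projv_id e : repr (\pi_Q x) - x \in ideal_vspace I.
    by rewrite -memvN opprB sub_repr_pi.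
  rewrite -[repr _](subrK x) -[X in h (X + _)]scale1r h_lin scale1r.
  by rewrite {1}/h e subrr linear0 add0r.
exists (fun q => f (h (repr q))).
  move=> a; elim/quotW=> x; elim/quotW=> y.
  by rewrite -f_lin -pi_quot_linear !h_pi h_lin.
exists (fun r => \pi_Q (vsval (g r))).
  elim/quotW=> x; rewrite fK h_pi; apply/pi_eq.
  rewrite /h vsprojK ?memv_projC // addrAC subrr add0r rpredN.
  exact: memv_proj.
move=> r; rewrite h_pi -[RHS]gK; congr f.
have /eqP e : projv I (vsval (g r)) == 0.
  by rewrite -memv_ker lker_proj subvsP.
by rewrite /h e subr0 vsvalK.
Qed.

HB.instance Definition _ := Lmodule_hasFinDim.Build K Q quot_hasFinDim.

Fact quot_mul_bilinear : bilinear_for *:%R *:%R quot_mul.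
Proof.
split.
  elim/quotW=> z a; elim/quotW=> x; elim/quotW=> y.
  by rewrite -pi_quot_linear -!pi_quot_mul -pi_quot_linear linearPl.
elim/quotW=> z a; elim/quotW=> x; elim/quotW=> y.
by rewrite -pi_quot_linear -!pi_quot_mul -pi_quot_linear linearPr.
Qed.

HB.instance Definition _ :=
  Vector_isNonAssocAlg.Build K Q quot_mul_bilinear.

Lemma pi_amul : {morph (\pi_Q : A -> Q) : x y / amul x y}.
Proof. exact: pi_quot_mul. Qed.

End QuotientAlgebra.

Section EvolutionAlgebras.

Context {K : fieldType} (A : nonAssocAlgType K).

Definition natural_basis (B : seq A) : Prop :=
  basis_of fullv B /\ {in B &, forall x y, x != y -> amul x y = 0}.

Definition evolution_algebra : Prop := exists B : seq A, natural_basis B.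

Definition square_alg : {vspace A} :=
  <<[seq amul x y | x <- vbasis (fullv : {vspace A}),
                    y <- vbasis (fullv : {vspace A})]>>%VS.

(* square_alg is the linear span of all products: it contains them            *)
(* (memv_square) and is the least such subspace (square_alg_min).             *)
Lemma memv_square x y : amul x y \in square_alg.
Proof.
rewrite (coord_vbasis (memvf x)) (coord_vbasis (memvf y)) linear_sumlz /=.
apply: rpred_sum => i _; rewrite linearZl_LR rpredZ //= linear_sumr /=.
apply: rpred_sum => j _; rewrite linearZr_LR rpredZ //=.
by apply/memv_span/allpairs_f; rewrite mem_nth ?size_tuple.
Qed.

Lemma square_alg_min (U : {vspace A}) :
  (forall x y, amul x y \in U) -> (square_alg <= U)%VS.
Proof. by move=> UM; apply/span_subvP=> _ /allpairsP[p [_ _ ->]]. Qed.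

Definition perfect : Prop := square_alg = fullv.

Definition i_basic_ideal_rel (B : seq A) (i : nat) (I : ideal A) : Prop :=
  [/\ (ideal_vspace I != 0)%VS, (ideal_vspace I != fullv)%VS &
      exists S : seq A,
        [/\ uniq S, {subset S <= B}, size S = i & ideal_vspace I = <<S>>%VS]].

Definition basic_ideal_rel (B : seq A) (I : ideal A) : Prop :=
  exists i, i_basic_ideal_rel B i I.

Definition maximal_i_basic_ideal_rel (B : seq A) (i : nat) (I : ideal A) :
    Prop :=
  i_basic_ideal_rel B i I /\
  forall J : ideal A, basic_ideal_rel B J -> ~ (i < \dim J)%N.

Definition maximal_i_basic_ideal (i : nat) (I : ideal A) : Prop :=
  forall B : seq A, natural_basis B -> maximal_i_basic_ideal_rel B i I.

Definition ideal_gen (x y : A) : Prop :=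
  forall J : ideal A, x \in ideal_vspace J -> y \in ideal_vspace J.

Definition basic_simple : Prop :=
  forall B : seq A, natural_basis B ->
  forall e, e \in B -> forall y, ideal_gen e y.

End EvolutionAlgebras.

(* Main.v *)
Require Import Defs.
From HB Require Import structures.
From mathcomp Require Import all_boot all_algebra.

(** In a perfect evolution algebra [A] every ideal is spanned by part of any
    given natural basis [B]: this is [ideal_span_filter].  Perfectness makes the
    squares of the vectors of [B] a basis of [A] (they span the square of [A],
    and there are [\dim A] of them).  For an ideal [J], let [D] be the set of
    vectors of [B] whose square lies in [J].  If [b] occurs in some [x] of [J]
    with coefficient [c != 0], then [x * b = c (b * b)] lies in [J], so [b] is in
    [D]; hence [J] is contained in the span of [D].  Conversely [J] contains
    [#|D|] linearly independent squares, so the dimensions agree.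

    Consequently a maximal basic ideal [I] is a maximal ideal: an ideal strictly
    between [I] and [A] would be basic and of larger dimension.  A nonzero
    element [e] of [A / I] thus generates [A / I], since the preimage of an ideal
    containing [e] is an ideal of [A] strictly larger than [I].  That [A / I] is
    a perfect evolution algebra holds because products map to products and the
    vectors of [B] outside [I] map to a natural basis: they span [A / I] and
    their number is [\dim A - \dim I]. *)

Set Implicit Arguments.
Unset Strict Implicit.
Unset Printing Implicit Defensive.

Import GRing.Theory.
Local Open Scope ring_scope.
Local Open Scope quotient_scope.

Section NaturalBases.

Context {K : fieldType} {A : nonAssocAlgType K}.
Implicit Types (B : seq A) (J : ideal A).

Lemma natural_basis_coord B x : natural_basis B ->
  x = \sum_i coord (in_tuple B) i x *: B`_i.
Proof.
case=> /andP[/eqP spanB _] _.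
by apply: (coord_span (X := in_tuple B)); rewrite spanB memvf.
Qed.

Lemma natural_basis_mulr B x (i : 'I_(size B)) : natural_basis B ->
  amul x B`_i = coord (in_tuple B) i x *: amul B`_i B`_i.
Proof.
move=> natB; have [/andP[_ freeB] orthB] := natB.
rewrite {1}(natural_basis_coord x natB) linear_sumlz (bigD1 i) //=.
rewrite linearZl_LR big1 ?addr0 // => j ji; rewrite linearZl_LR /=.
by rewrite orthB ?scaler0 ?mem_nth // nth_uniq ?free_uniq.
Qed.

(** The squares span the square of the algebra, which is everything, and they
    are as many as the dimension. *)
Lemma perfect_squares_basis B : natural_basis B -> perfect A ->
  basis_of fullv [seq amul b b | b <- B].
Proof.
move=> natB perfA; rewrite basisEdim size_map; apply/andP; split; last first.
  by rewrite (size_basis (X := in_tuple B) natB.1).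
rewrite -[X in (X <= _)%VS]perfA; apply: square_alg_min => x y.
rewrite (natural_basis_coord y natB) linear_sumr /=; apply: rpred_sum => i _.
rewrite linearZr_LR /= natural_basis_mulr // !rpredZ // memv_span //.
by apply/mapP; exists B`_i; rewrite ?mem_nth.
Qed.

(** The predicate selects the vectors whose square, rather than the vectors
    themselves, lies in [J]: this is what multiplying an element of [J] by a
    basis vector shows, and independence of the squares bounds their number by
    [\dim J]. *)
Lemma ideal_span_filter B J : natural_basis B -> perfect A ->
  ideal_vspace J = <<[seq b <- B | amul b b \in ideal_vspace J]>>%VS.
Proof.
move=> natB perfA; set D := filter _ _.
have sub_JD : (ideal_vspace J <= <<D>>)%VS.
  apply/subvP=> x xJ; rewrite (natural_basis_coord x natB).
  apply: rpred_sum => i _; have [->|ci_neq0] := eqVneq (coord (in_tuple B) i x) 0.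
    by rewrite scale0r mem0v.
  rewrite rpredZ // memv_span // mem_filter mem_nth // andbT.
  have := (ideal_closedP (i := J) B`_i xJ).2.
  by rewrite natural_basis_mulr // rpredZeq (negPf ci_neq0).
apply/eqP; rewrite eqEdim sub_JD /=; apply: leq_trans (dim_span D) _.
have free_sq : free [seq amul b b | b <- D].
  rewrite -(filter_map (fun b => amul b b) (mem (ideal_vspace J))).
  exact/filter_free/(basis_free (perfect_squares_basis natB perfA)).
rewrite -(size_map (fun b => amul b b) D) -(eqP free_sq); apply/dimvS/span_subvP.
by move=> _ /mapP[b + ->]; rewrite mem_filter => /andP[].
Qed.

Lemma perfect_basic_ideal B J : natural_basis B -> perfect A ->
  ideal_vspace J != 0%VS -> ideal_vspace J != fullv -> basic_ideal_rel B J.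
Proof.
move=> natB perfA J_neq0 J_neqA.
pose S := [seq b <- B | amul b b \in ideal_vspace J].
exists (size S); split=> //; exists S; split=> //.
- by rewrite filter_uniq // free_uniq // (basis_free natB.1).
- by move=> b; rewrite mem_filter => /andP[].
- exact: ideal_span_filter.
Qed.

Lemma dim_i_basic_ideal B i J : natural_basis B ->
  i_basic_ideal_rel B i J -> \dim J = i.
Proof.
move=> [basisB _] [_ _ [S [uniqS subSB <- ->]]]; apply/eqP.
suff: free S by [].
have permS : perm_eq S [seq b <- B | b \in S].
  apply: uniq_perm => //; first by rewrite filter_uniq // free_uniq // (basis_free basisB).
  move=> b; rewrite mem_filter; case: (boolP (b \in S)) => // bS.
  by rewrite subSB.
by rewrite (perm_free permS) filter_free // (basis_free basisB).
Qed.

(** Since every ideal is basic, maximality among basic ideals is maximality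
    among all ideals. *)
Lemma maximal_basic_ideal_maximal B i (I J : ideal A) :
  natural_basis B -> perfect A -> maximal_i_basic_ideal_rel B i I ->
  (I <= J)%VS -> ~~ (J <= I)%VS -> ideal_vspace J = fullv.
Proof.
move=> natB perfA [basicI maxI] subIJ not_subJI; apply/eqP/negPn/negP => J_neqA.
have J_neq0 : ideal_vspace J != 0%VS.
  by apply: contraNneq not_subJI => ->; rewrite sub0v.
apply: (maxI J (perfect_basic_ideal natB perfA J_neq0 J_neqA)).
rewrite -(dim_i_basic_ideal natB basicI) ltnNge.
apply: contra not_subJI => dimJI.
have /eqP-> : ideal_vspace I == ideal_vspace J by rewrite eqEdim subIJ.
exact: subvv.
Qed.

End NaturalBases.

Section Quotient.

Context {K : fieldType} {A : nonAssocAlgType K} (I : ideal A).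
Local Notation Q := (ideal_quotient I).

(** The projection, under a name that can carry a linear structure with values
    in the quotient seen as an algebra. *)
Definition quot_proj (x : A) : Q := \pi_Q x.

HB.instance Definition _ :=
  GRing.isLinear.Build K A Q *:%R quot_proj (@pi_quot_linear K A I).

Lemma quot_projM x y : quot_proj (amul x y) = amul (quot_proj x) (quot_proj y).
Proof. exact: pi_amul. Qed.

Lemma quot_proj_eq0 x : (quot_proj x == 0) = (x \in ideal_vspace I).
Proof.
rewrite -(linear0 quot_proj) -[x in RHS]subr0.
by apply/eqP/idP => /(pi_eq I x 0).
Qed.

Lemma perfect_quotient : perfect A -> perfect Q.
Proof.
move=> perfA; apply/eqP; rewrite eqEsubv subvf /=; apply/subvP; elim/quotW=> x _.
have : x \in (linfun quot_proj @^-1: square_alg Q)%VS.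
  have /subvP : (square_alg A <= linfun quot_proj @^-1: square_alg Q)%VS.
    apply: square_alg_min => y z.
    by rewrite -memv_preim lfunE /= quot_projM memv_square.
  by apply; rewrite perfA memvf.
by rewrite -memv_preim lfunE.
Qed.

Lemma natural_basis_quotient (B : seq A) (p : pred A) : natural_basis B ->
  ideal_vspace I = <<[seq b <- B | p b]>>%VS ->
  natural_basis [seq quot_proj b | b <- B & ~~ p b].
Proof.
move=> natB spanI; have [basisB orthB] := natB; split; last first.
  move=> _ _ /mapP[b + ->] /mapP[c + ->]; rewrite !mem_filter.
  move=> /andP[_ bB] /andP[_ cB] neq_bc; rewrite -quot_projM orthB ?linear0 //.
  by apply: contraNneq neq_bc => ->.
rewrite basisEdim; apply/andP; split.
  apply/subvP; elim/quotW=> x _; rewrite -[\pi_ _ x]/(quot_proj x).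
  rewrite (natural_basis_coord x natB) linear_sum; apply: rpred_sum => j _.
  rewrite linearZ rpredZ //=; have [pj|npj] := boolP (p B`_j).
    have /eqP -> : quot_proj B`_j == 0; last exact: mem0v.
    by rewrite quot_proj_eq0 spanI memv_span // mem_filter pj mem_nth.
  by apply/memv_span/map_f; rewrite mem_filter npj mem_nth.
have -> : \dim (fullv : {vspace Q}) = \dim (I^C)%VS by rewrite dimvf.
have freeB := basis_free basisB.
rewrite size_map dimv_compl (size_basis (X := in_tuple B) basisB).
rewrite spanI (eqP (filter_free p freeB)) !size_filter.
by rewrite -(count_predC p B) addKn.
Qed.

Lemma preim_ideal_closed (J : ideal Q) :
  ideal_closed (linfun quot_proj @^-1: J)%VS.
Proof.
move=> x u; rewrite -!memv_preim !lfunE /= !quot_projM.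
exact: (ideal_closedP (i := J)).
Qed.

Definition preim_ideal (J : ideal Q) : ideal A := Ideal (@preim_ideal_closed J).

Lemma mem_preim_ideal (J : ideal Q) x :
  (x \in ideal_vspace (preim_ideal J)) = (quot_proj x \in ideal_vspace J).
Proof. by rewrite -memv_preim lfunE. Qed.

(** Pulling back along the projection turns maximality of [I] into simplicity of
    the quotient. *)
Lemma quotient_ideal_gen :
  (forall J : ideal A, (I <= J)%VS -> ~~ (J <= I)%VS -> ideal_vspace J = fullv) ->
  forall e : Q, e != 0 -> forall y, ideal_gen e y.
Proof.
move=> maxI; elim/quotW=> e; rewrite -[\pi_ _ e]/(quot_proj e) quot_proj_eq0 => eNI.
elim/quotW=> y J eJ; rewrite -[\pi_ _ y]/(quot_proj y) -mem_preim_ideal.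
rewrite maxI ?memvf //.
  apply/subvP=> x; rewrite mem_preim_ideal -quot_proj_eq0 => /eqP->.
  exact: mem0v.
by apply: contra eNI => /subvP; apply; rewrite mem_preim_ideal.
Qed.

End Quotient.

Theorem proposition2p10 (K : fieldType) (A : nonAssocAlgType K) (n i : nat)
    (I : ideal A) :
  evolution_algebra A -> perfect A ->
  \dim (fullv : {vspace A}) = n -> (2 <= n)%N ->
  maximal_i_basic_ideal i I ->
  [\/ i = 1%N, i = (n - 1)%N | ~~ odd n /\ i = (n %/ 2)%N] ->
  [/\ evolution_algebra (ideal_quotient I),
      perfect (ideal_quotient I) &
      basic_simple (ideal_quotient I)].
Proof.
move=> [B natB] perfA _ _ maxI _; split.
- by eexists; apply: natural_basis_quotient natB (ideal_span_filter I natB perfA).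
- exact: perfect_quotient.
move=> C [basisC _] e eC; apply: quotient_ideal_gen.
  by move=> J; apply: (maximal_basic_ideal_maximal natB perfA (maxI B natB)).
exact: free_not0 (basis_free basisC) eC.
Qed.
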